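(* Let $\mathcal{H}=\mathcal{H}(X)$ be a reproducing kernel Hilbert space, let $A,B\in\mathscr{B}(\mathcal{H})$, let $\sigma,\rho,\tau$ be symmetric means with corresponding interpolational paths $(\sigma_t)_{t\in[0,1]}$, $(\rho_t)_{t\in[0,1]}$, $(\tau_t)_{t\in[0,1]}$, and let $\mu,\nu,\lambda\in[0,1]$. If $f$ is a multiplicative Orlicz function, then for every $\zeta\ge 0$, $$ \begin{aligned} f\big(\mathrm{ber}^4(A^*B)\big)\le{}&\frac{2\zeta+1}{8\zeta+8}\Big\|f\big((B^*B)^2\big)+f\big((A^*A)^2\big)\Big\|_{\mathrm{ber}}^2\\ &+\frac{1}{2\zeta+2}\Bigg(\bigg(f\big(\mathrm{ber}^2(A^*AB^*B)\big)\ \sigma_\mu\ \frac12 f\big(\mathrm{ber}(A^*AB^*B)\big)\Big\|f\big((B^*B)^2\big)+f\big((A^*A)^2\big)\Big\|_{\mathrm{ber}}\bigg)\\ &\qquad\rho_\lambda\ \bigg(f\big(\mathrm{ber}^2(A^*AB^*B)\big)\ \tau_\nu\ \frac14\Big\|f\big((B^*B)^2\big)+f\big((A^*A)^2\big)\Big\|_{\mathrm{ber}}^2\bigg)\Bigg). \end{aligned} $$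
   Context: Reproducing kernel Hilbert space: $X$ is a non-empty set and $\mathcal{H}=\mathcal{H}(X)$ is a Hilbert space of complex-valued functions on $X$ such that for every $x\in X$ the evaluation $\phi\mapsto\phi(x)$ is continuous on $\mathcal{H}$. For $x\in X$, $k_x\in\mathcal{H}$ is the unique element with $\phi(x)=\langle\phi,k_x\rangle$ for all $\phi\in\mathcal{H}$, and $\hat k_x=k_x/\|k_x\|$ is the normalized reproducing kernel (so it is implicit that $k_x\neq 0$ for all $x\in X$). $\mathscr{B}(\mathcal{H})$ is the algebra of bounded linear operators on $\mathcal{H}$. For $T\in\mathscr{B}(\mathcal{H})$, the Berezin number is $\mathrm{ber}(T)=\sup_{x\in X}|\langle T\hat k_x,\hat k_x\rangle|$ and the Berezin norm is $\|T\|_{\mathrm{ber}}=\sup_{x,y\in X}|\langle T\hat k_x,\hat k_y\rangle|$; $\mathrm{ber}^s(T)$ means $(\mathrm{ber}(T))^s$. Mean: a function $\sigma:[0,\infty)\times[0,\infty)\to[0,\infty)$ such that (1) $\sigma(a,b)\ge0$; (2) $a\le\sigma(a,b)\le b$ if $a\le b$; (3) $\sigma$ is monotone increasing in both variables; (4) $\sigma(\alpha a,\alpha b)=\alpha\sigma(a,b)$ for all $\alpha>0$; (5) $\sigma$ is continuous in $a$ and $b$. It is symmetric if $\sigma(a,b)=\sigma(b,a)$. An interpolational path for a symmetric mean $\sigma$ is a family $(\sigma_t)_{t\in[0,1]}$ of means on $[0,\infty)\times[0,\infty)$ such that (i) $\sigma_0(a,b)=a$, $\sigma_1(a,b)=b$,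 $\sigma_{1/2}(a,b)=\sigma(a,b)$ for all $a,b\ge0$; (ii) $\sigma(\sigma_s(a,b),\sigma_t(a,b))=\sigma_{(s+t)/2}(a,b)$ for all $s,t\in[0,1]$; (iii) each $\sigma_t$ is increasing in each of its components. One writes $a\,\sigma_t\,b$ for $\sigma_t(a,b)$. Orlicz function: a continuous, convex, non-decreasing $f:[0,\infty)\to[0,\infty)$ with $f(0)=0$ and $f(u)\to\infty$ as $u\to\infty$; throughout, Orlicz functions are assumed non-degenerate, i.e. $f(u)>0$ for all $u>0$. Multiplicative means $f(ab)=f(a)f(b)$ for all $a,b\ge0$. For a positive operator $T$, $f(T)$ is defined by the continuous functional calculus. *)

(* Defs.v *)
From HB Require Import structures.
From mathcomp Require Import all_boot all_order all_algebra sesquilinear complex.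
From mathcomp Require Import all_classical all_reals all_analysis.
Set Implicit Arguments.
Unset Strict Implicit.
Unset Printing Implicit Defensive.
Import Order.TTheory GRing.Theory Num.Theory.
Import numFieldNormedType.Exports.
Import ComplexField.
Local Open Scope classical_set_scope.
Local Open Scope complex_scope.
Local Open Scope ring_scope.

(* A Hilbert space of complex-valued functions on X with continuous point
   evaluations.  The vectors form an abstract complete normed space; rk_eval is
   the linear injection that identifies a vector with a function on X.  The
   inner product is linear on the left and conjugate-linear on the right. *)
Record rkHilbert (R : realType) (X : Type) := RkHilbert {
  rk_space :> completeNormedModType R[i] ;
  rk_inner : {dot rk_space for Num.conj} ;
  rk_innerE : forall u : rk_space, rk_inner u u = `|u| ^+ 2 ;
  rk_eval : rk_space -> X -> R[i] ;
  rk_eval_linear : forall (a : R[i]) (u v : rk_space) (x : X),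
    rk_eval (a *: u + v) x = a * rk_eval u x + rk_eval v x ;
  rk_eval_inj : injective rk_eval ;
  rk_eval_continuous : forall x : X,
    continuous (fun u : rk_space => rk_eval u x : R[i]^o) }.

Arguments rk_inner {R X} _.
Arguments rk_eval {R X} _.

Section Operators.
Variables (R : realType) (X : Type) (H : rkHilbert R X).

Local Notation "''[' u , v ]" := (rk_inner H u v) : ring_scope.

Definition is_kernel (x : X) (k : H) := forall u : H, rk_eval H u x = '[u, k].

(* k_x; such a vector exists and is unique by the Riesz representation
   theorem, so the default value 0 is never used. *)
Definition rkernel (x : X) : H := xget 0 [set k : H | is_kernel x k].

Definition nkernel (x : X) : H := `|rkernel x|^-1 *: rkernel x.

(* Membership in B(H). *)
Definition bounded_op (T : H -> H) := linear T /\ continuous T.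

Definition is_adjoint (T S : H -> H) :=
  bounded_op S /\ forall u v : H, '[T u, v] = '[u, S v].

(* T^*; it exists and is unique for every bounded operator T. *)
Definition adjoint (T : H -> H) : H -> H :=
  xget (fun=> 0) [set S | is_adjoint T S].

Definition ber (T : H -> H) : R :=
  sup (range (fun x : X => Normc.normc '[T (nkernel x), nkernel x])).

Definition ber_norm (T : H -> H) : R :=
  sup (range (fun xy : X * X =>
    Normc.normc '[T (nkernel xy.1), nkernel xy.2])).

Definition spectrum (T : H -> H) : set R[i] :=
  [set z | ~ exists S : H -> H, [/\ bounded_op S,
     forall u, S (T u - z *: u) = u & forall u, T (S u) - z *: S u = u]].

Definition poly_op (p : {poly R}) (T : H -> H) : H -> H :=
  fun u => \sum_(i < size p) (p`_i)%:C *: iter i T u.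

(* S = f(T) for a positive operator T: S is the limit in operator norm of
   p_n(T) for real polynomials p_n converging to f uniformly on the spectrum
   of T.  As T is positive its spectrum lies in [0, +oo[, so that only the real
   points t of the spectrum occur; and the limit does not depend on (p_n). *)
Definition is_cfc (f : R -> R) (T S : H -> H) :=
  bounded_op S /\ exists p : nat -> {poly R},
    (forall e : R, 0 < e -> \forall n \near \oo, forall t : R,
       spectrum T t%:C -> `|(p n).[t] - f t| <= e) /\
    (forall e : R, 0 < e -> \forall n \near \oo, forall u : H,
       `|poly_op (p n) T u - S u| <= e%:C * `|u|).

(* f(T); it exists and is unique if T is a positive bounded operator and f is
   continuous on [0, +oo[. *)
Definition cfc (f : R -> R) (T : H -> H) : H -> H :=
  xget (fun=> 0) [set S | is_cfc f T S].

End Operators.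

(* Functions on [0, +oo[ and on [0, +oo[ x [0, +oo[ are represented by total
   functions on R, constrained only at nonnegative arguments. *)
Section Functions.
Variable R : realType.

Record is_mean (s : R -> R -> R) : Prop := IsMean {
  mean_ge0 : forall a b, 0 <= a -> 0 <= b -> 0 <= s a b ;
  mean_between : forall a b, 0 <= a -> a <= b -> a <= s a b <= b ;
  mean_mono : forall a a' b b', 0 <= a -> a <= a' -> 0 <= b -> b <= b' ->
    s a b <= s a' b' ;
  mean_homog : forall c a b, 0 < c -> 0 <= a -> 0 <= b ->
    s (c * a) (c * b) = c * s a b ;
  mean_continuousl : forall b, 0 <= b ->
    {within `[0, +oo[, continuous (fun a => s a b)} ;
  mean_continuousr : forall a, 0 <= a ->
    {within `[0, +oo[, continuous (fun b => s a b)} }.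

Definition symmetric_mean (s : R -> R -> R) :=
  is_mean s /\ forall a b, 0 <= a -> 0 <= b -> s a b = s b a.

Record interpolational_path (s : R -> R -> R) (st : R -> R -> R -> R) : Prop :=
  InterpolationalPath {
  path_mean : forall t, 0 <= t <= 1 -> is_mean (st t) ;
  path_0 : forall a b, 0 <= a -> 0 <= b -> st 0 a b = a ;
  path_1 : forall a b, 0 <= a -> 0 <= b -> st 1 a b = b ;
  path_half : forall a b, 0 <= a -> 0 <= b -> st 2^-1 a b = s a b ;
  path_mid : forall p t a b, 0 <= p <= 1 -> 0 <= t <= 1 -> 0 <= a -> 0 <= b ->
    s (st p a b) (st t a b) = st ((p + t) / 2) a b ;
  path_mono : forall t a a' b b', 0 <= t <= 1 ->
    0 <= a -> a <= a' -> 0 <= b -> b <= b' -> st t a b <= st t a' b' }.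

(* Non-degenerate Orlicz functions. *)
Record orlicz (f : R -> R) : Prop := Orlicz {
  orlicz_ge0 : forall u, 0 <= u -> 0 <= f u ;
  orlicz_continuous : {within `[0, +oo[, continuous f} ;
  orlicz_convex : convex_function (`[0, +oo[%classic : set R) f ;
  orlicz_mono : forall u v, 0 <= u -> u <= v -> f u <= f v ;
  orlicz_0 : f 0 = 0 ;
  orlicz_pinfty : f u @[u --> +oo] --> +oo ;
  orlicz_gt0 : forall u, 0 < u -> 0 < f u }.

Definition multiplicative_nneg (f : R -> R) :=
  forall a b, 0 <= a -> 0 <= b -> f (a * b) = f a * f b.

End Functions.

(* Main.v *)
Require Import Defs.
From HB Require Import structures.
From mathcomp Require Import all_boot all_order all_algebra sesquilinear complex.
From mathcomp Require Import all_classical all_reals all_analysis.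
From mathcomp Require Import ring lra.
Set Implicit Arguments.
Unset Strict Implicit.
Unset Printing Implicit Defensive.
Import Order.TTheory GRing.Theory Num.Theory.
Import numFieldNormedType.Exports.
Local Open Scope classical_set_scope.
Local Open Scope ring_scope.

(* Write [P = B^*B], [Q = A^*A], and let [k] be a normalised kernel.  Then
   [|<A^*B k, k>|^4 <= s^2] with [s = <P k, k> <Q k, k>].  On the one hand
   [s <= U := |P k| |Q k|]; on the other hand Buzano's inequality gives
   [s <= (U + V) / 2] with [V = |<QP k, k>|].  Hence [s^2] is at most [U^2], and
   also at most the convex combination of [U^2] and [V^2] with weights
   [(2 zeta + 1) / (2 zeta + 2)] and [1 / (2 zeta + 2)].  As [f] is convex and
   multiplicative, Jensen's inequality [f <T k, k> <= <f(T) k, k>] for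
   [T = P^2, Q^2] bounds [f(U^2)] by [N^2 / 4].  Since every mean is at least
   the minimum of its arguments, the right-hand side only gets smaller when the
   means are replaced by [min (f(ber(QP))^2) (N^2 / 4)], and the two bounds on
   [s^2] cover the two possible values of that minimum.

   Jensen's inequality rests on a spectral lower bound: if a real polynomial [p]
   is at least [c] on the real spectrum of a self-adjoint [T], then
   [p(T) >= c].  Indeed let [g] be the infimum of the numerical range of [p(T)].
   Then [p(T) - g] is not bounded below, so neither is one of the factors
   [T - z] of its factorisation over the complex numbers; such a [z] is real,
   lies in the spectrum and satisfies [p(z) = g]. *)

(** Test the vertex [-a/b]. When [b = 0] the expression is affine in [s], and [a != 0] would let it
    reach -1. *)
Lemma quad_ge0_discr (R : realFieldType) (a b c : R) : 0 <= b ->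
  (forall s : R, 0 <= c + 2 * s * a + s ^+ 2 * b) -> a ^+ 2 <= b * c.
Proof.
rewrite le_eqVlt => /predU1P[<-|b0] h; last first.
  have := h (- a / b).
  have bN : b != 0 by rewrite gt_eqF.
  have -> : c + 2 * (- a / b) * a + (- a / b) ^+ 2 * b = (b * c - a ^+ 2) / b.
    by field.
  by rewrite ler_pdivlMr // mul0r subr_ge0.
rewrite mul0r; suff -> : a = 0 by rewrite expr0n.
apply/eqP/contraT => a0.
have := h (- (c + 1) / (2 * a)).
set t := - (c + 1) / (2 * a).
have -> : c + 2 * t * a + t ^+ 2 * 0 = - 1 by rewrite /t; field.
by rewrite oppr_ge0 ler10.
Qed.

(** * Real inner product and bounded operators *)

Section Hilbert.
Variables (R : realType) (X : Type) (H : rkHilbert R X).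
Local Notation C := R[i].
Local Notation "x %:C" := (real_complex R x) : ring_scope.
Local Notation "''[' u , v ]" := (rk_inner H u v) : ring_scope.
Implicit Types (u v w : H) (T S : H -> H).

(** The norm and inner product of [H] are complex numbers; taking real parts brings estimates into
    the ordered field [R]. *)
Definition hnorm u : R := complex.Re `|u|.
Definition rip u v : R := complex.Re '[u, v].

Lemma normE u : `|u| = (hnorm u)%:C.
Proof. by rewrite /hnorm RRe_real // normr_real. Qed.

Lemma hnorm_ge0 u : 0 <= hnorm u.
Proof. by rewrite -ler0c -normE. Qed.

Lemma hnorm_eq0 u : hnorm u = 0 -> u = 0.
Proof. by move=> h; apply/normr0_eq0; rewrite normE h. Qed.

Lemma normc_normE (z : C) : `|z| = (Normc.normc z)%:C.
Proof. by rewrite normc_def; case: z. Qed.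

Lemma hnormZ (a : C) u : hnorm (a *: u) = Normc.normc a * hnorm u.
Proof.
apply: (@complexI R).
by rewrite -normE normrZ normE normc_normE rmorphM.
Qed.

Lemma hnormZr (a : R) u : hnorm (a%:C *: u) = `|a| * hnorm u.
Proof. by rewrite hnormZ /= expr0n addr0 sqrtr_sqr. Qed.

Lemma ler_hnormD u v : hnorm (u + v) <= hnorm u + hnorm v.
Proof. by rewrite -lecR rmorphD /= -!normE ler_normD. Qed.

Lemma opp_hnorm u : hnorm (- u) = hnorm u.
Proof. by rewrite /hnorm normrN. Qed.

Lemma hnorm0 : hnorm 0 = 0.
Proof. by rewrite /hnorm normr0. Qed.

Lemma hnorm_distC u v : hnorm (u - v) = hnorm (v - u).
Proof. by rewrite /hnorm distrC. Qed.

Lemma innerDl u v w : '[u + v, w] = '[u, w] + '[v, w].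
Proof. exact: linearDl. Qed.
Lemma innerZl (a : C) u w : '[a *: u, w] = a * '[u, w].
Proof. exact: linearZl_LR. Qed.
Lemma inner_conj u v : '[u, v] = conjc '[v, u].
Proof. by rewrite hermC /= expr0 mul1r. Qed.

Lemma ripC u v : rip u v = rip v u.
Proof. by rewrite /rip inner_conj; case: '[v, u]. Qed.
Lemma ripDl u v w : rip (u + v) w = rip u w + rip v w.
Proof. by rewrite /rip innerDl raddfD. Qed.
Lemma ripDr u v w : rip w (u + v) = rip w u + rip w v.
Proof. by rewrite !(ripC w) ripDl. Qed.
Lemma ripZl (a : R) u w : rip (a%:C *: u) w = a * rip u w.
Proof.
by rewrite /rip innerZl; case: '[u, w] => x y /=; rewrite mul0r subr0.
Qed.
Lemma ripZr (a : R) u w : rip w (a%:C *: u) = a * rip w u.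
Proof. by rewrite !(ripC w) ripZl. Qed.
Lemma ripNl u w : rip (- u) w = - rip u w.
Proof. by rewrite -scaleN1r -(rmorphN1 (real_complex R)) ripZl mulN1r. Qed.
Lemma ripNr u w : rip w (- u) = - rip w u.
Proof. by rewrite !(ripC w) ripNl. Qed.
Lemma ripBl u v w : rip (u - v) w = rip u w - rip v w.
Proof. by rewrite ripDl ripNl. Qed.
Lemma ripBr u v w : rip w (u - v) = rip w u - rip w v.
Proof. by rewrite ripDr ripNr. Qed.
Lemma rip0l w : rip 0 w = 0.
Proof. by rewrite -(subrr w) ripBl subrr. Qed.
Lemma rip0r w : rip w 0 = 0.
Proof. by rewrite ripC rip0l. Qed.
Lemma ripE u : rip u u = hnorm u ^+ 2.
Proof. by rewrite /rip rk_innerE normE -rmorphXn. Qed.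

Section LinearOps.
Variable (T : H -> H).
Hypothesis lT : linear T.

Lemma linop0 : T 0 = 0.
Proof.
have := lT 1 0 0; rewrite !scale1r !addr0 => /esym/eqP.
by rewrite -subr_eq0 addrK => /eqP.
Qed.
Lemma linopD u v : T (u + v) = T u + T v.
Proof. by have := lT 1 u v; rewrite !scale1r. Qed.
Lemma linopZ (a : C) u : T (a *: u) = a *: T u.
Proof. by have := lT a u 0; rewrite !addr0 linop0 addr0. Qed.
Lemma linopN u : T (- u) = - T u.
Proof. by rewrite -scaleN1r linopZ scaleN1r. Qed.
Lemma linopB u v : T (u - v) = T u - T v.
Proof. by rewrite linopD linopN. Qed.
End LinearOps.

Lemma rip_eqP u v : (forall w, rip u w = rip v w) -> u = v.
Proof.
move=> h; apply/eqP; rewrite -subr_eq0; apply/eqP/hnorm_eq0/eqP.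
by rewrite -(sqrf_eq0 (hnorm _)) -ripE ripBl h subrr.
Qed.

Lemma rip_imag u v : complex.Im '[u, v] = - rip (complex.Complex 0 1 *: u) v.
Proof.
rewrite /rip innerZl; case: '[u, v] => x y /=.
by rewrite mul0r mul1r sub0r opprK.
Qed.

(** As [T] is complex linear, testing the hypothesis on [i u] yields the imaginary parts. *)
Lemma inner_eqP (T : H -> H) v x : linear T ->
  (forall u, rip (T u) v = rip u x) -> forall u, '[T u, v] = '[u, x].
Proof.
move=> lT h u; apply/eqP; rewrite eq_complex -!/(rip _ _) h eqxx !rip_imag -h.
by rewrite (linopZ lT) eqxx.
Qed.

(** Semidefinite rather than definite, so that Cauchy-Schwarz also covers [rip (S u) v] for a
    positive operator [S]. *)
Definition psd_form (B : H -> H -> R) :=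
  [/\ forall u v, B u v = B v u,
      forall u v w, B (u + v) w = B u w + B v w,
      forall (a : R) u w, B (a%:C *: u) w = a * B u w
    & forall u, 0 <= B u u].

Lemma form_CS B : psd_form B -> forall u v, B u v ^+ 2 <= B u u * B v v.
Proof.
move=> [BC BD BZ B0] u v; rewrite [leRHS]mulrC; apply: quad_ge0_discr => // s.
have := B0 (u + s%:C *: v).
set w := s%:C *: v; rewrite BD !(BC _ (u + w)) !BD [B u w]BC.
rewrite !BZ [B v w]BC BZ [B v u]BC => /le_trans; apply.
by rewrite le_eqVlt; apply/predU1P; left; ring.
Qed.

Lemma rip_form : psd_form rip.
Proof.
split; [exact: ripC|exact: ripDl|exact: ripZl|].
by move=> u; rewrite ripE sqr_ge0.
Qed.

Lemma rip_CS u v : `|rip u v| <= hnorm u * hnorm v.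
Proof.
rewrite -ler_sqr ?nnegrE ?mulr_ge0 ?hnorm_ge0 // exprMn -!ripE.
rewrite real_normK ?num_real //.
exact: form_CS rip_form u v.
Qed.

Lemma Re_le_normc (z : C) : `|complex.Re z| <= Normc.normc z.
Proof. by rewrite -lecR -normc_normE normc_ge_Re. Qed.

Lemma normc_conj (z : C) : Normc.normc (conjc z) = Normc.normc z.
Proof. by case: z => a b /=; rewrite sqrrN. Qed.

Lemma normc_ge0 (z : C) : 0 <= Normc.normc z.
Proof. by case: z => a b /=; rewrite sqrtr_ge0. Qed.

(** Scaling [u] by the conjugate of ['[u, v]] makes the inner product real, so [rip_CS] applies; one
    factor [|'[u, v]|] then cancels. *)
Lemma inner_CS u v : Normc.normc '[u, v] <= hnorm u * hnorm v.
Proof.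
have [z0|z0] := eqVneq '[u, v] 0.
  by rewrite z0 Normc.normc0 mulr_ge0 ?hnorm_ge0.
set z := '[u, v] in z0 *.
have nz : 0 < Normc.normc z.
  rewrite lt_def normc_ge0 andbT.
  by apply: contraNneq z0 => /Normc.eq0_normc ->.
have h := rip_CS (conjc z *: u) v; rewrite hnormZ normc_conj in h.
suff e : rip (conjc z *: u) v = Normc.normc z ^+ 2.
  move: h; rewrite e normrX ger0_norm ?normc_ge0 // expr2 -mulrA.
  by rewrite ler_pM2l.
rewrite /rip innerZl -/z; case: (z) => a b /=.
by rewrite sqr_sqrtr ?addr_ge0 ?sqr_ge0 // mulNr opprK !expr2.
Qed.

End Hilbert.

(** * Completeness and minimisation of quadratic functionals *)

Section Complete.
Variables (R : realType) (X : Type) (H : rkHilbert R X).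
Local Notation C := R[i].
Local Notation "x %:C" := (real_complex R x) : ring_scope.
Local Notation "''[' u , v ]" := (rk_inner H u v) : ring_scope.
Implicit Types (u v w : H) (T S A : H -> H).

Lemma gt0_real_complex (e : C) : 0 < e -> exists2 r : R, 0 < r & e = r%:C.
Proof.
move=> e0; have := gtr0_real e0 => /complex_realP [r rE].
by exists r => //; rewrite -ltcR -rE.
Qed.

Lemma hnorm_complete (y : nat -> H) :
  (forall e : R, 0 < e -> exists n0 : nat, forall m n : nat,
     (n0 <= m)%N -> (n0 <= n)%N -> hnorm (y m - y n) <= e) ->
  exists l : H, forall e : R, 0 < e -> exists n0 : nat, forall n : nat,
     (n0 <= n)%N -> hnorm (y n - l) <= e.
Proof.
move=> yC.
have yc : cauchy (y @ \oo).
  apply: cauchy_exP => e /gt0_real_complex [r r0 ->].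
  (* Halving [r] turns the non-strict bound into the strict one of a ball. *)
  have [|n0 hn] := yC (r / 2); first by rewrite divr_gt0.
  exists (y n0); exists n0 => // n /= n0n.
  rewrite -ball_normE /= normE ltcR (le_lt_trans (hn _ _ (leqnn _) n0n)) //.
  by rewrite ltr_pdivrMr // ltr_pMr // ltr1n.
have /cauchy_cvgP/cvg_ex [l yl] := yc.
exists l => e e0.
have /cvgrPdist_le /(_ (e%:C)) := yl.
rewrite ltcR => /(_ e0) [n0 _ hn]; exists n0 => n n0n.
by have := hn n n0n; rewrite /= normE lecR hnorm_distC.
Qed.

Lemma bounded_op_bound T : bounded_op T ->
  exists2 M : R, 0 <= M & forall u, hnorm (T u) <= M * hnorm u.
Proof.
move=> [lT cT].
pose f : {linear H -> H} := HB.pack T (GRing.isLinear.Build C H H *:%R T lT).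
have /linear_bounded_continuous/linear_boundedP h : continuous f by [].
have /pinfty_ex_gt0 [M /gt0_real_complex [r r0 ->] hM] := h.
exists r; first exact: ltW.
by move=> u; have := hM u; rewrite /= !normE -rmorphM lecR.
Qed.

Lemma bound_bounded_op T (M : R) : linear T ->
  (forall u, hnorm (T u) <= M * hnorm u) -> bounded_op T.
Proof.
move=> lT hM; split => //.
pose f : {linear H -> H} := HB.pack T (GRing.isLinear.Build C H H *:%R T lT).
suff : continuous f by [].
apply/linear_bounded_continuous/linear_boundedP.
exists M%:C; split; first by apply/complex_realP; exists M.
move=> x Mx u; rewrite /= normE.
apply: (@le_trans _ _ (M%:C * `|u|)); first by rewrite normE -rmorphM lecR.
by rewrite ler_wpM2r // ltW.
Qed.

Definition selfadj T := forall u v, rip (T u) v = rip u (T v).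

(* The functional [rip (A u) u - 2 * phi u] is strictly convex; a minimising
   sequence is Cauchy by the parallelogram identity, and at its limit the
   derivative in every direction vanishes. *)
Lemma lax_milgram A (phi : H -> R) (M c d : R) :
  linear A -> selfadj A -> (forall u, hnorm (A u) <= M * hnorm u) ->
  0 < d -> (forall u, d * hnorm u ^+ 2 <= rip (A u) u) ->
  (forall u v, phi (u + v) = phi u + phi v) ->
  (forall (a : R) u, phi (a%:C *: u) = a * phi u) ->
  (forall u, `|phi u| <= c * hnorm u) ->
  exists x, forall u, rip (A x) u = phi u.
Proof.
move=> lA sA bA d0 cA pD pZ bp.
pose B u v := rip (A u) v.
have BC u v : B u v = B v u by rewrite /B sA ripC.
have BD u v w : B (u + v) w = B u w + B v w by rewrite /B (linopD lA) ripDl.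
have BZ (a : R) u w : B (a%:C *: u) w = a * B u w.
  by rewrite /B (linopZ lA) ripZl.
have Bq u : d * hnorm u ^+ 2 <= B u u by exact: cA.
have B0 u : 0 <= B u u.
  by apply: le_trans (Bq u); rewrite mulr_ge0 ?sqr_ge0 ?ltW.
pose J u := B u u - 2 * phi u.
(* Complete the square in [d |u|^2 - 2 c |u|]. *)
have Jlb u : - (c ^+ 2 / d) <= J u.
  have h1 := Bq u; have h2 : phi u <= c * hnorm u.
    by apply: le_trans (bp u); exact: ler_norm.
  have : 0 <= (d * hnorm u - c) ^+ 2 / d by rewrite divr_ge0 ?sqr_ge0 ?ltW.
  have -> : (d * hnorm u - c) ^+ 2 / d =
      d * hnorm u ^+ 2 - 2 * (c * hnorm u) + c ^+ 2 / d.
    by field; rewrite gt_eqF.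
  rewrite /J; lra.
pose E := range J.
have hE : has_inf E.
  split; first by exists (J 0), 0.
  by exists (- (c ^+ 2 / d)) => _ [u _ <-].
pose j := inf E.
have jJ u : j <= J u by apply: ge_inf; [exact: hE.2|exists u].
have ex n : exists u, J u < j + n.+1%:R^-1.
  have n0 : (0 : R) < n.+1%:R^-1 by rewrite invr_gt0 ltr0Sn.
  have [_ [u _ <-] h] := inf_adherent n0 hE.
  by exists u.
have [y hy] := choice ex.
(* [J u + J v - 2 J ((u + v) / 2) = B (u - v) (u - v) / 2], and [J] at the midpoint is at least
   [j]. *)
have par u v : d / 2 * hnorm (u - v) ^+ 2 <= J u + J v - 2 * j.
  have h := jJ ((2^-1 : R)%:C *: (u + v)).
  have h2 := Bq (u - v).
  rewrite /J BZ BC BZ pZ pD BD !(BC _ (u + v)) !BD in h.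
  rewrite -(scaleN1r v) -(rmorphN1 (real_complex R)) BD !(BC _ (u + _)) in h2.
  rewrite !BD !(BC u (_ *: _)) !BZ (BC v (_ *: _)) BZ rmorphN1 scaleN1r in h2.
  rewrite (BC v u) in h h2; rewrite /J.
  lra.
have [z zP] : exists x, forall e : R, 0 < e -> exists n0 : nat,
    forall n : nat, (n0 <= n)%N -> hnorm (y n - x) <= e.
  apply: hnorm_complete => e ep.
  (* The excesses of [J (y m)] and [J (y n)] over [j] add up in [par]; a quarter for each gives
     exactly [d / 2 * e ^+ 2]. *)
  have d2 : 0 < d / 4 * e ^+ 2 by rewrite mulr_gt0 ?exprn_gt0 // divr_gt0.
  pose n0 := Num.truncn (d / 4 * e ^+ 2)^-1.
  exists n0.
  have small n : (n0 <= n)%N -> n.+1%:R^-1 <= d / 4 * e ^+ 2.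
    move=> n0n; rewrite -[leRHS]invrK lef_pV2 ?posrE ?invr_gt0 ?ltr0Sn //.
    apply: le_trans (ltW (truncnS_gt _)) _.
    by rewrite ler_nat ltnS.
  move=> m n /small hm /small hn.
  rewrite -(@ler_pXn2r _ 2) ?nnegrE ?hnorm_ge0 ?(ltW ep) //.
  have := par (y m) (y n); have := hy m; have := hy n => h1 h2 h3.
  have : d / 2 * hnorm (y m - y n) ^+ 2 <= d / 2 * e ^+ 2.
    apply: le_trans h3 _; move: hm hn h1 h2.
    move: (J (y n)) (J (y m)) (n.+1%:R^-1) (m.+1%:R^-1) => *; lra.
  by rewrite ler_pM2l ?divr_gt0 //.
exists z => w; apply/eqP; rewrite -subr_eq0; apply/eqP.
(* [2 a] is the derivative of [J] at [z] along [w]. Letting [n] grow in [j <= J (y n + s w)] gives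
   [0 <= 2 s a + s^2 B w w] for all [s], whose discriminant forces [a = 0]. *)
set a := _ - _.
suff : a ^+ 2 <= B w w * 0.
  by rewrite mulr0 => h; apply/eqP; rewrite -sqrf_eq0 eq_le h sqr_ge0.
apply: quad_ge0_discr => // s; rewrite add0r.
apply/ler_addgt0Pr => e ep.
(* [K - 1] bounds the effect of replacing [y n] by [z], per unit of distance; adding 1 makes [K] a
   legitimate divisor. *)
pose K := 2 * `|s| * (`|M| * hnorm w) + 1.
have K0 : 0 < K.
  by rewrite /K ltr_wpDl // !mulr_ge0 // hnorm_ge0.
have [|n1 hn1] := zP (e / 2 / K); first by rewrite !divr_gt0.
pose n2 := Num.truncn (e / 2)^-1.
pose n := maxn n1 n2.
have hx := hn1 n (leq_maxl _ _).
have hn : n.+1%:R^-1 <= e / 2.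
  rewrite -[leRHS]invrK lef_pV2 ?posrE ?invr_gt0 ?ltr0Sn ?divr_gt0 //.
  apply: le_trans (ltW (truncnS_gt _)) _.
  by rewrite ler_nat ltnS leq_maxr.
have h := jJ (y n + s%:C *: w); have h' := hy n.
rewrite /J BD !(BC _ (y n + _)) !BD BZ (BC (y n) (_ *: _)) BZ in h.
rewrite (BC w (_ *: _)) !BZ pD pZ in h.
have hB : B w (y n) - B w z = B (y n - z) w.
  by rewrite /B (linopB lA) ripBl -!/(B _ _) ![B w _]BC.
have hle : 2 * `|s * (B w (y n) - B w z)| <= e / 2.
  rewrite normrM hB.
  have h1 : `|B (y n - z) w| <= `|M| * hnorm w * (e / 2 / K).
    apply: le_trans (rip_CS _ _) _.
    rewrite mulrAC ler_wpM2r ?hnorm_ge0 //.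
    apply: le_trans (bA _) _.
    apply: le_trans (ler_wpM2r (hnorm_ge0 _) (ler_norm M)) _.
    by rewrite ler_wpM2l.
  apply: (@le_trans _ _ (2 * (`|s| * (`|M| * hnorm w * (e / 2 / K))))).
    by rewrite !ler_wpM2l.
  have -> : 2 * (`|s| * (`|M| * hnorm w * (e / 2 / K))) = (K - 1) / K * (e / 2).
    by rewrite /K; field; rewrite -/K gt_eqF.
  rewrite ler_piMl ?divr_ge0 ?(ltW ep) // ler_pdivrMr // mul1r.
  lra.
have h3 := ler_norm (s * (B w (y n) - B w z)).
have aE : a = B w z - phi w by rewrite /a -/(B _ _) BC.
rewrite aE.
have : J (y n) < j + e / 2 by apply: lt_le_trans h' _; rewrite lerD2l.
rewrite /J in h' * => h4.
move: h h4 hle h3.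
move: (B (y n) (y n)) (B w (y n)) (B w z) (B w w) (phi (y n)) (phi w) => *.
lra.
Qed.

End Complete.

(** * Adjoints, coercive inverses and location of the spectrum *)

Section Inverses.
Variables (R : realType) (X : Type) (H : rkHilbert R X).
Local Notation C := R[i].
Local Notation "x %:C" := (real_complex R x) : ring_scope.
Local Notation "''[' u , v ]" := (rk_inner H u v) : ring_scope.
Implicit Types (u v w : H) (T S A : H -> H).

(** Riesz representation is [lax_milgram] with [A = id]; applied to [u |-> rip (T u) v] it produces
    [S v]. The bound on [S] comes from [|S v|^2 = rip (T (S v)) v]. *)
Lemma adjointP T : bounded_op T -> is_adjoint T (adjoint T).
Proof.
move=> bT; apply: (@xgetPex _ (fun=> 0) [set S | is_adjoint T S]).
have [lT _] := bT; have [M M0 hM] := bounded_op_bound bT.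
have /choice [S hS] : forall v, exists x, forall u, rip x u = rip (T u) v.
  move=> v; apply: (@lax_milgram _ _ _ id _ 1 (M * hnorm v) 1) => //.
  - by move=> u; rewrite mul1r.
  - by move=> u; rewrite mul1r ripE.
  - by move=> u w; rewrite (linopD lT) ripDl.
  - by move=> a u; rewrite (linopZ lT) ripZl.
  - move=> u; apply: le_trans (rip_CS _ _) _.
    by rewrite mulrAC ler_wpM2r ?hnorm_ge0.
have SE v u : '[T u, v] = '[u, S v].
  by apply: inner_eqP => // {}u; rewrite -hS ripC.
exists S; split => //.
have lS : linear S.
  move=> a u v; apply: rip_eqP => w.
  rewrite ripC /rip -SE linearPr /= !SE -linearPr //.
  by rewrite -/(rip _ _) ripC.
apply: (@bound_bounded_op _ _ _ _ M lS) => v.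
have [->|v0] := eqVneq (hnorm (S v)) 0; first by rewrite mulr_ge0 ?hnorm_ge0.
rewrite -(@ler_pM2l _ (hnorm (S v))); last by rewrite lt_def v0 hnorm_ge0.
rewrite -expr2 -ripE hS; apply: le_trans (ler_norm _) _.
apply: le_trans (rip_CS _ _) _.
by rewrite mulrA [_ * M]mulrC ler_wpM2r ?hnorm_ge0.
Qed.

(** [lax_milgram] with the functional [rip v] solves [A x = v]; coercivity gives injectivity and the
    bound [d^-1] on the inverse. *)
Lemma coercive_inverse A (d : R) : bounded_op A -> selfadj A -> 0 < d ->
  (forall u, d * hnorm u ^+ 2 <= rip (A u) u) ->
  exists S, [/\ bounded_op S, forall u, S (A u) = u & forall u, A (S u) = u].
Proof.
move=> bA sA d0 cA; have [lA _] := bA; have [M M0 hM] := bounded_op_bound bA.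
have A_inj u v : A u = A v -> u = v.
  move=> e; apply/eqP; rewrite -subr_eq0; apply/eqP/hnorm_eq0/eqP.
  have := cA (u - v); rewrite (linopB lA) e subrr rip0l pmulr_rle0 //.
  by rewrite -(sqrf_eq0 (hnorm _)) eq_le sqr_ge0 andbT.
have /choice [S hS] : forall v, exists x, A x = v.
  move=> v.
  have [x hx] : exists x, forall u, rip (A x) u = rip v u.
    apply: (@lax_milgram _ _ _ A _ M (hnorm v) d) => //.
    - by move=> u w; rewrite ripDr.
    - by move=> a u; rewrite ripZr.
    - by move=> u; exact: rip_CS.
  by exists x; exact: rip_eqP.
exists S; split => //; last by move=> u; apply: A_inj; rewrite hS.
have lS : linear S by move=> a u v; apply: A_inj; rewrite lA !hS.
apply: (@bound_bounded_op _ _ _ _ d^-1 lS) => v.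
have [->|v0] := eqVneq (hnorm (S v)) 0.
  by rewrite mulr_ge0 ?hnorm_ge0 // invr_ge0 ltW.
rewrite mulrC ler_pdivlMr // -(@ler_pM2l _ (hnorm (S v))); last first.
  by rewrite lt_def v0 hnorm_ge0.
rewrite mulrA -expr2 mulrC; apply: le_trans (cA _) _.
by rewrite hS mulrC; apply: le_trans (ler_norm _) (rip_CS _ _).
Qed.

Lemma bounded_op_shift T (a b : R) : bounded_op T ->
  bounded_op (fun u => a%:C *: T u + b%:C *: u).
Proof.
move=> bT; have [lT _] := bT; have [M M0 hM] := bounded_op_bound bT.
apply: (@bound_bounded_op _ _ _ _ (`|a| * M + `|b|)) => [c u v|u].
  by rewrite lT !scalerDr !scalerA ![c * _]mulrC addrACA.
apply: le_trans (ler_hnormD _ _) _.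
by rewrite !hnormZr mulrDl lerD2r -mulrA ler_wpM2l.
Qed.

Lemma selfadj_shift T (a b : R) : selfadj T ->
  selfadj (fun u => a%:C *: T u + b%:C *: u).
Proof. by move=> sT u v; rewrite ripDl ripDr !ripZl !ripZr sT. Qed.

(** For [t < 0] the operator [T - t] is coercive with constant [-t]; for [t > M] it is [t - T] that
    is coercive, with constant [t - M], and its inverse is negated. *)
Lemma spectrum_bounds T (M t : R) : bounded_op T -> selfadj T ->
  (forall u, 0 <= rip (T u) u) -> (forall u, hnorm (T u) <= M * hnorm u) ->
  spectrum T t%:C -> 0 <= t <= M.
Proof.
move=> bT sT pT hM; rewrite /spectrum /=; apply: contra_notP => /negP.
rewrite negb_and -!ltNge => /orP[t0|Mt].
  have [|u|S [bS SA AS]] := @coercive_inverse _ (- t)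
    (bounded_op_shift 1 (- t) bT) (selfadj_shift 1 (- t) sT).
  - by rewrite oppr_gt0.
  - by rewrite ripDl !ripZl ripE mul1r lerDr.
  have E u : T u - t%:C *: u = 1%:C *: T u + (- t)%:C *: u.
    by rewrite scale1r rmorphN scaleNr.
  by exists S; split=> // u; rewrite E.
have [|u|S [bS SA AS]] := @coercive_inverse _ (t - M)
  (bounded_op_shift (- 1) t bT) (selfadj_shift (- 1) t sT).
- by rewrite subr_gt0.
- rewrite ripDl !ripZl ripE mulN1r mulrBl [leRHS]addrC lerD2l lerN2.
  apply: le_trans (ler_norm _) _; apply: le_trans (rip_CS _ _) _.
  by rewrite expr2 mulrA ler_wpM2r ?hnorm_ge0.
have E u : (- 1)%:C *: T u + t%:C *: u = - (T u - t%:C *: u).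
  by rewrite rmorphN1 scaleN1r opprB addrC.
exists (fun u => - S u); split=> [|u|u].
- have [lS _] := bS; have [K K0 hK] := bounded_op_bound bS.
  apply: (@bound_bounded_op _ _ _ _ K) => [c u v|u]; last by rewrite opp_hnorm.
  by rewrite lS opprD scalerN.
- by have := SA u; rewrite E (linopN (proj1 bS)).
- by have := AS u; rewrite E (linopN (proj1 bT)) scalerN opprD.
Qed.

End Inverses.

(** * Polynomials of a linear operator *)

Section PolyCalculus.
Variables (K : comNzRingType) (V : lmodType K) (T : V -> V).
Hypothesis TD : forall u v, T (u + v) = T u + T v.
Hypothesis TZ : forall a u, T (a *: u) = a *: T u.

Implicit Types (p q : {poly K}) (u v : V).

(** Unlike [poly_op], this allows complex coefficients, which splitting into linear factors
    requires. *)
Definition poly_act (p : {poly K}) (u : V) : V :=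
  \sum_(i < size p) p`_i *: iter i T u.

Lemma poly_act_widen n p u : (size p <= n)%N ->
  poly_act p u = \sum_(i < n) p`_i *: iter i T u.
Proof.
move=> pn; rewrite /poly_act (big_ord_widen n (fun i => p`_i *: iter i T u) pn).
rewrite big_mkcond /=; apply: eq_bigr => i _; case: ltnP => // pi.
by rewrite nth_default // scale0r.
Qed.

Lemma poly_actD p q u : poly_act (p + q) u = poly_act p u + poly_act q u.
Proof.
pose n := maxn (size p) (size q).
rewrite !(@poly_act_widen n) ?leq_maxl ?leq_maxr ?size_polyD // -big_split /=.
by apply: eq_bigr => i _; rewrite coefD scalerDl.
Qed.

Lemma poly_actC c u : poly_act c%:P u = c *: u.
Proof.
rewrite (@poly_act_widen 1) ?size_polyC ?leq_b1 //.
by rewrite big_ord_recl big_ord0 coefC /= addr0.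
Qed.

Lemma poly_actCM c p u : poly_act (c%:P * p) u = c *: poly_act p u.
Proof.
rewrite (@poly_act_widen (size p)) ?mul_polyC ?size_scale_leq // scaler_sumr.
by apply: eq_bigr => i _; rewrite coefZ scalerA.
Qed.

Lemma lin_sum (I : Type) (s : seq I) (F : I -> V) :
  T (\sum_(i <- s) F i) = \sum_(i <- s) T (F i).
Proof.
elim: s => [|i s IH]; last by rewrite !big_cons TD IH.
by rewrite !big_nil; have := TZ 0 0; rewrite !scale0r.
Qed.

Lemma poly_actMX p u : poly_act (p * 'X) u = T (poly_act p u).
Proof.
rewrite (@poly_act_widen (size p).+1); last first.
  by rewrite (leq_trans (size_polyMleq _ _)) // size_polyX addn2.
rewrite big_ord_recl coefMX /= scale0r add0r lin_sum.
by apply: eq_bigr => i _; rewrite coefMX /= TZ.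
Qed.

Lemma poly_actX u : poly_act 'X u = T u.
Proof. by rewrite -['X]mul1r poly_actMX -[1]/(1%:P) poly_actC scale1r. Qed.

Lemma poly_actM p q u : poly_act (p * q) u = poly_act p (poly_act q u).
Proof.
elim/poly_ind: p => [|p c IH].
  by rewrite mul0r -polyC0 !poly_actC !scale0r.
by rewrite mulrDl mulrAC !poly_actD !poly_actMX poly_actCM poly_actC IH.
Qed.

End PolyCalculus.

(** * Spectral lower bound for polynomials of a self-adjoint operator *)

Section Spectral.
Variables (R : realType) (X : Type) (H : rkHilbert R X).
Local Notation C := R[i].
Local Notation "x %:C" := (real_complex R x) : ring_scope.
Local Notation "''[' u , v ]" := (rk_inner H u v) : ring_scope.
Implicit Types (u v w : H) (T S G : H -> H).

Definition bounded_below S :=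
  exists2 d : R, 0 < d & forall u, d * hnorm u <= hnorm (S u).

(** Cauchy-Schwarz for the form [rip (S u) v] at [u] and [S u] gives
    [|S u|^4 <= rip (S u) u * M |S u|^2]. *)
Lemma psd_hnorm_sqr S (M : R) : linear S -> selfadj S ->
  (forall u, 0 <= rip (S u) u) -> 0 <= M ->
  (forall u, hnorm (S u) <= M * hnorm u) ->
  forall u, hnorm (S u) ^+ 2 <= M * rip (S u) u.
Proof.
move=> lS sS pS M0 hM u.
have fB : psd_form (fun u v => rip (S u) v).
  split=> [v w|v v' w|a v w|//]; first by rewrite sS ripC.
  - by rewrite (linopD lS) ripDl.
  - by rewrite (linopZ lS) ripZl.
have [e|e0] := eqVneq (hnorm (S u)) 0.
  by rewrite e expr0n mulr_ge0.
have h0 : 0 < hnorm (S u) ^+ 2 by rewrite exprn_gt0 // lt_def e0 hnorm_ge0.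
rewrite -(ler_pM2r h0) -ripE -expr2.
apply: le_trans (form_CS fB _ _) _.
rewrite mulrAC [leLHS]mulrC ler_wpM2r //.
apply: le_trans (ler_norm _) _; apply: le_trans (rip_CS _ _) _.
by rewrite ripE expr2 mulrA ler_wpM2r ?hnorm_ge0.
Qed.

Lemma hnorm_normalize u : u != 0 -> hnorm ((hnorm u)^-1%:C *: u) = 1.
Proof.
move=> u0; have h0 : hnorm u != 0 by apply: contraNneq u0 => /hnorm_eq0 ->.
by rewrite hnormZr ger0_norm ?invr_ge0 ?hnorm_ge0 // mulVf.
Qed.

(** Take for [g] the infimum of [rip (G u) u] over unit vectors. If the positive operator [G - g]
    were bounded below by [d], [psd_hnorm_sqr] would keep the numerical range a fixed distance above
    [g]. *)
Lemma inf_numerical_range G : bounded_op G -> selfadj G ->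
  (exists u : H, u != 0) -> exists g : R,
  (forall u, g * hnorm u ^+ 2 <= rip (G u) u) /\
  ~ bounded_below (fun u => G u - g%:C *: u).
Proof.
move=> bG sG [u0 u00]; have [lG _] := bG.
have [M M0 hM] := bounded_op_bound bG.
pose E := [set rip (G u) u | u in [set u | hnorm u = 1]].
have hE : has_inf E.
  split.
    pose v := (hnorm u0)^-1%:C *: u0.
    by exists (rip (G v) v); exists v => //; exact: hnorm_normalize.
  exists (- M) => _ [u /= u1 <-]; rewrite lerNl.
  apply: le_trans (ler_norm _) _; rewrite normrN.
  by apply: le_trans (rip_CS _ _) _; rewrite u1 mulr1 -[M]mulr1 -u1 hM.
have [g gE] : exists g, g = inf E by exists (inf E).
exists g.
have gle u : g * hnorm u ^+ 2 <= rip (G u) u.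
  have [->|un0] := eqVneq u 0; first by rewrite hnorm0 expr0n mulr0 rip0r.
  have h0 : hnorm u != 0 by apply: contraNneq un0 => /hnorm_eq0 ->.
  have : g <= rip (G ((hnorm u)^-1%:C *: u)) ((hnorm u)^-1%:C *: u).
    rewrite gE; apply: ge_inf; first exact: hE.2.
    by exists ((hnorm u)^-1%:C *: u); rewrite /= ?hnorm_normalize.
  rewrite (linopZ lG) ripZl ripZr mulrA -invfM -expr2 mulrC ler_pdivlMr //.
  by rewrite exprn_gt0 // lt_def h0 hnorm_ge0.
split => // -[d d0 hd].
pose W u := 1%:C *: G u + (- g)%:C *: u.
have WE u : G u - g%:C *: u = W u by rewrite /W scale1r rmorphN scaleNr.
have bW : bounded_op W by exact: bounded_op_shift.
have [K K0 hK] := bounded_op_bound bW.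
have psd u : 0 <= rip (W u) u.
  by rewrite /W ripDl !ripZl mul1r ripE mulNr subr_ge0.
have K1 : 0 < K + 1 by rewrite ltr_wpDl.
(* The bound [K] may be 0, hence the divisor [K + 1]. *)
have [|_ [u /= u1 <-]] := @inf_adherent _ E (d ^+ 2 / (K + 1)) _ hE.
  by rewrite divr_gt0 // exprn_gt0.
rewrite -gE -ltrBlDl ltNge => /negP; apply.
have h := psd_hnorm_sqr (proj1 bW) (selfadj_shift _ _ sG) psd K0 hK u.
have Wu : rip (W u) u = rip (G u) u - g.
  by rewrite /W ripDl !ripZl mul1r ripE u1 expr1n mulr1.
rewrite Wu in h; have h2 := psd u; rewrite Wu in h2.
rewrite ler_pdivrMr //.
have := hd u; rewrite u1 mulr1 WE => h3.
have : d ^+ 2 <= hnorm (W u) ^+ 2.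
  by rewrite ler_sqr ?nnegrE ?hnorm_ge0 ?(ltW d0).
move: h h2 K0; move: (_ - g) (hnorm _ ^+ 2) (d ^+ 2) => a b c; nra.
Qed.

Section Fixed.
Variable T : H -> H.
Hypotheses (bT : bounded_op T) (sT : selfadj T).
Let lT : linear T := proj1 bT.
Let TD := linopD lT.
Let TZ := linopZ lT.

Lemma poly_opE (p : {poly R}) u :
  poly_op p T u = poly_act T (map_poly (real_complex R) p) u.
Proof.
rewrite /poly_op /poly_act size_map_poly; apply: eq_bigr => i _.
by rewrite coef_map.
Qed.

Lemma poly_opD (p q : {poly R}) u :
  poly_op (p + q) T u = poly_op p T u + poly_op q T u.
Proof. by rewrite !poly_opE rmorphD poly_actD. Qed.

Lemma poly_opM (p q : {poly R}) u :
  poly_op (p * q) T u = poly_op p T (poly_op q T u).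
Proof. by rewrite !poly_opE rmorphM poly_actM. Qed.

Lemma poly_opC (c : R) u : poly_op c%:P T u = c%:C *: u.
Proof. by rewrite poly_opE map_polyC poly_actC. Qed.

Lemma poly_opX u : poly_op 'X T u = T u.
Proof. by rewrite poly_opE map_polyX poly_actX. Qed.

Lemma poly_opN (p : {poly R}) u : poly_op (- p) T u = - poly_op p T u.
Proof. by rewrite -mulN1r -polyCN poly_opM poly_opC rmorphN1 scaleN1r. Qed.

Lemma poly_opB (p q : {poly R}) u :
  poly_op (p - q) T u = poly_op p T u - poly_op q T u.
Proof. by rewrite poly_opD poly_opN. Qed.

Lemma poly_op_bounded (p : {poly R}) : bounded_op (poly_op p T).
Proof.
have [M M0 hM] := bounded_op_bound bT.
elim/poly_ind: p => [|p c IH].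
  have E u : poly_op 0 T u = 0 by rewrite -polyC0 poly_opC scale0r.
  apply: (@bound_bounded_op _ _ _ _ 0) => [a u v|u].
    by rewrite !E scaler0 addr0.
  by rewrite E hnorm0 mul0r.
have E u : poly_op (p * 'X + c%:P) T u = poly_op p T (T u) + c%:C *: u.
  by rewrite poly_opD poly_opM poly_opX poly_opC.
have [lp _] := IH; have [K K0 hK] := bounded_op_bound IH.
apply: (@bound_bounded_op _ _ _ _ (K * M + `|c|)) => [a u v|u]; rewrite !E.
  by rewrite lT lp !scalerDr !scalerA [c%:C * a]mulrC addrACA.
apply: le_trans (ler_hnormD _ _) _; rewrite hnormZr mulrDl lerD2r -mulrA.
by apply: le_trans (hK _) _; rewrite ler_wpM2l.
Qed.

Lemma poly_op_selfadj (p : {poly R}) : selfadj (poly_op p T).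
Proof.
elim/poly_ind: p => [|p c IH] u v.
  by rewrite -polyC0 !poly_opC !ripZl !ripZr.
rewrite {1}[p * _]mulrC !poly_opD !poly_opM !poly_opX !poly_opC.
by rewrite ripDl ripDr ripZl ripZr sT IH.
Qed.

(** Since ['[T u, u]] is real, the imaginary part of ['[T u - z *: u, u]] is [- Im z * |u|^2]. *)
Lemma nonreal_bounded_below (z : C) : complex.Im z != 0 ->
  bounded_below (fun u => T u - z *: u).
Proof.
move=> z0; exists `|complex.Im z|; first by rewrite normr_gt0.
move=> u; have [->|un0] := eqVneq (hnorm u) 0; first by rewrite mulr0 hnorm_ge0.
have h0 : 0 < hnorm u by rewrite lt_def un0 hnorm_ge0.
rewrite -(ler_pM2r h0) -mulrA.
apply: le_trans (inner_CS _ _).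
have e : complex.Im '[T u, u] = 0.
  have : '[T u, u] = conjc '[T u, u].
    rewrite -inner_conj; apply: (@inner_eqP _ _ _ T u (T u) lT) => v.
    exact: sT.
  by case: '[T u, u] => a b /= []; lra.
have : complex.Im '[T u - z *: u, u] = - (complex.Im z * (hnorm u * hnorm u)).
  rewrite -[- (z *: u)]scaleNr innerDl innerZl rk_innerE normE -rmorphXn.
  rewrite raddfD /= e expr2.
  by case: (z) => a b /=; ring.
have Imle (w : C) : `|complex.Im w| <= Normc.normc w.
  by case: w => a b /=; rewrite -sqrtr_sqr ler_wsqrtr // lerDr sqr_ge0.
have := Imle '[T u - z *: u, u] => /[swap] ->.
by rewrite normrN normrM [`|_ * hnorm u|]ger0_norm // mulr_ge0 // ltW.
Qed.

Lemma bounded_below_prod (s : seq C) :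
  (forall z, z \in s -> bounded_below (fun u => T u - z *: u)) ->
  bounded_below (poly_act T (\prod_(z <- s) ('X - z%:P))).
Proof.
elim: s => [|z s IH] hs.
  exists 1 => // u; by rewrite big_nil -polyC1 poly_actC mul1r scale1r.
have [|d d0 hd] := IH; first by move=> w ws; apply: hs; rewrite inE ws orbT.
have [|e e0 he] := hs z; first by rewrite inE eqxx.
exists (e * d) => [|u]; first exact: mulr_gt0.
rewrite big_cons poly_actM // -polyCN poly_actD poly_actX // poly_actC scaleNr.
by apply: le_trans (he _); rewrite -mulrA ler_wpM2l // ltW.
Qed.

Lemma not_spectrum_bounded_below (z : C) : ~ spectrum T z ->
  bounded_below (fun u => T u - z *: u).
Proof.
move=> /contrapT [S [bS ST _]]; have [M M0 hM] := bounded_op_bound bS.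
have M1 : 0 < M + 1 by rewrite ltr_wpDl.
exists (M + 1)^-1; first by rewrite invr_gt0.
move=> u; rewrite mulrC ler_pdivrMr // -{1}(ST u).
apply: le_trans (hM _) _; rewrite mulrC ler_wpM2l ?hnorm_ge0 //.
by rewrite lerDl.
Qed.

(** Factor [q] over the complex numbers. A real root lies outside the spectrum and a non-real one is
    harmless, so every linear factor is bounded below. *)
Lemma poly_op_bounded_below (q : {poly R}) : q != 0 ->
  (forall t : R, spectrum T t%:C -> q.[t] != 0) -> bounded_below (poly_op q T).
Proof.
move=> q0 hq; pose Q := map_poly (real_complex R) q.
have Q0 : Q != 0 by rewrite map_poly_eq0.
have [r Qr] := closed_field_poly_normal Q.
have [|d d0 hd] := @bounded_below_prod r.
  move=> z zr; have [z0|z0] := eqVneq (complex.Im z) 0; last first.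
    exact: nonreal_bounded_below.
  apply: not_spectrum_bounded_below.
  have zE : z = (complex.Re z)%:C by case: (z) z0 => a b /= ->.
  rewrite zE => /hq; apply/negP; rewrite negbK.
  have : root Q z.
    by rewrite Qr rootZ ?lead_coef_eq0 // root_prod_XsubC.
  by rewrite zE /root horner_map fmorph_eq0.
exists (Normc.normc (lead_coef Q) * d) => [|u].
  rewrite mulr_gt0 // lt_def normc_ge0 andbT.
  by apply: contraNneq Q0 => /Normc.eq0_normc/eqP; rewrite lead_coef_eq0.
have -> : poly_op q T u =
    lead_coef Q *: poly_act T (\prod_(z <- r) ('X - z%:P)) u.
  by rewrite -poly_actCM mul_polyC -Qr poly_opE.
by rewrite hnormZ -mulrA ler_wpM2l ?normc_ge0.
Qed.

(** Were there no real spectrum, [X - g] would vacuously satisfy [poly_op_bounded_below], against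
    the choice of [g]. *)
Lemma spectrum_nonempty :
  (exists u : H, u != 0) -> exists t : R, spectrum T t%:C.
Proof.
move=> /(inf_numerical_range bT sT) [g [_ ng]].
apply/not_existsP => h; apply: ng.
have [|t /h//|d d0 hd] := @poly_op_bounded_below ('X - g%:P).
  by rewrite polyXsubC_eq0.
by exists d => // u; have := hd u; rewrite poly_opB poly_opX poly_opC.
Qed.

Lemma poly_op_lower_bound (p : {poly R}) (c : R) :
  (forall t : R, spectrum T t%:C -> c <= p.[t]) ->
  forall u, c * hnorm u ^+ 2 <= rip (poly_op p T u) u.
Proof.
move=> hp u; have [->|u0] := eqVneq u 0.
  by rewrite hnorm0 expr0n mulr0 rip0r.
have ex : exists u : H, u != 0 by exists u.
have [g [hg ng]] :=
  inf_numerical_range (poly_op_bounded p) (poly_op_selfadj p) ex.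
apply: le_trans (hg u); rewrite ler_wpM2r ?sqr_ge0 //.
rewrite leNgt; apply/negP => gc; apply: ng.
have hq (t : R) : spectrum T t%:C -> (p - g%:P).[t] != 0.
  move=> /hp ct; rewrite hornerD hornerN hornerC subr_eq0 gt_eqF //.
  exact: lt_le_trans gc ct.
(* A point of the spectrum witnesses that [p - g] is not the zero polynomial. *)
have [t /hq ht] := spectrum_nonempty ex.
have [|d d0 hd] := poly_op_bounded_below _ hq.
  by apply: contraNneq ht => ->; rewrite horner0.
by exists d => // v; have := hd v; rewrite poly_opB poly_opC.
Qed.

(** Apply the lower bound 0 to [e^2 - p^2]: its quadratic form is [e^2 |u|^2 - |p(T) u|^2]. *)
Lemma poly_op_norm_le (p : {poly R}) (e : R) : 0 <= e ->
  (forall t : R, spectrum T t%:C -> `|p.[t]| <= e) ->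
  forall u, hnorm (poly_op p T u) <= e * hnorm u.
Proof.
move=> e0 hp u.
have := @poly_op_lower_bound ((e ^+ 2)%:P - p * p) 0 _ u.
rewrite mul0r poly_opB poly_opC poly_opM ripBl ripZl ripE poly_op_selfadj ripE.
rewrite subr_ge0 -exprMn ler_sqr ?nnegrE ?mulr_ge0 ?hnorm_ge0 //.
apply => t /hp h; rewrite hornerD hornerN hornerM hornerC subr_ge0 -expr2.
by rewrite -[leLHS]real_normK ?num_real // ler_sqr ?nnegrE.
Qed.

End Fixed.
End Spectral.

(** * Convexity and polynomial approximation *)

Section ConvexFunctions.
Variables (R : realType) (f : R -> R).
Hypothesis hf : orlicz f.

Lemma orlicz_conv (a x z : R) : 0 <= a <= 1 -> 0 <= x -> 0 <= z ->
  f (a * x + (1 - a) * z) <= a * f x + (1 - a) * f z.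
Proof.
move=> /andP[a0 a1] x0 z0.
have := orlicz_convex hf (Itv01 a0 a1) (x := x) (y := z).
by apply; rewrite inE /= in_itv /= andbT.
Qed.

Lemma orlicz_slope (x y z : R) : 0 <= x -> x < y -> y < z ->
  (f y - f x) / (y - x) <= (f z - f y) / (z - y).
Proof.
move=> x0 xy yz.
have xz : 0 < z - x by rewrite subr_gt0 (lt_trans xy).
have h : f y <= ((z - y) * f x + (y - x) * f z) / (z - x).
  have -> : ((z - y) * f x + (y - x) * f z) / (z - x) =
      (z - y) / (z - x) * f x + (1 - (z - y) / (z - x)) * f z.
    by field; rewrite gt_eqF.
  have {1}-> : y = (z - y) / (z - x) * x + (1 - (z - y) / (z - x)) * z.
    by field; rewrite gt_eqF.
  apply: orlicz_conv => //; last by lra.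
  rewrite divr_ge0 ?(ltW xz) ?subr_ge0 ?(ltW yz) //= ler_pdivrMr // mul1r.
  by lra.
rewrite ler_pdivlMr // in h.
by rewrite ler_pdivrMr ?subr_gt0 // mulrAC ler_pdivlMr ?subr_gt0 //; lra.
Qed.

(** The slope over [[x, y]] is at most that over [[y, K + 1]], an interval of length at least 1 on
    which [f] rises by at most [f (K + 1)]. *)
Lemma orlicz_lipschitz (K x y : R) : 0 <= K ->
  0 <= x <= K -> 0 <= y <= K -> `|f x - f y| <= f (K + 1) * `|x - y|.
Proof.
move=> K0; wlog xy : x y / x < y.
  move=> h hx hy; have [xy|xy|->] := ltgtP x y; first exact: h.
    by rewrite distrC [`|x - y|]distrC; exact: h.
  by rewrite !subrr !normr0 mulr0.
move=> /andP[x0 xK] /andP[y0 yK].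
have fxy : f x <= f y by apply: orlicz_mono => //; exact: ltW.
rewrite distrC [`|x - y|]distrC !ger0_norm ?subr_ge0 ?(ltW xy) //.
rewrite -ler_pdivrMr ?subr_gt0 //.
apply: (le_trans (@orlicz_slope x y (K + 1) x0 xy _)); first lra.
have fy := orlicz_ge0 hf y0.
have fK : 0 <= f (K + 1) by apply: orlicz_ge0 => //; lra.
rewrite ler_pdivrMr; last lra.
apply: (@le_trans _ _ (f (K + 1) * 1)); first lra.
rewrite ler_wpM2l //; lra.
Qed.

(** The supremum of the slopes to the left of [c] serves as [m]; at [c = 0] the horizontal line
    works. *)
Lemma orlicz_support (c : R) : 0 <= c ->
  exists m : R, forall t : R, 0 <= t -> f c + m * (t - c) <= f t.
Proof.
rewrite le_eqVlt => /predU1P[<-|c0].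
  by exists 0 => t t0; rewrite mul0r addr0 orlicz_0 // orlicz_ge0.
pose E := [set (f c - f s) / (c - s) | s in [set s | 0 <= s < c]].
have ub t : c < t -> ubound E ((f t - f c) / (t - c)).
  move=> ct _ [s /= /andP[s0 sc] <-]; exact: orlicz_slope.
have hE : has_sup E.
  split; first by exists ((f c - f 0) / (c - 0)); exists 0 => //=; rewrite lexx.
  by exists ((f (c + 1) - f c) / (c + 1 - c)); apply: ub; rewrite ltrDl.
exists (sup E) => t t0; have [tc|ct|->] := ltgtP t c.
- have : (f c - f t) / (c - t) <= sup E.
    by apply: sup_upper_bound => //; exists t => //=; rewrite t0.
  rewrite ler_pdivrMr ?subr_gt0 //; lra.
- have : sup E <= (f t - f c) / (t - c).
    by apply: sup_le_ub; [exact: hE.1|exact: ub].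
  rewrite ler_pdivlMr ?subr_gt0 //; lra.
- by rewrite subrr mulr0 addr0.
Qed.

End ConvexFunctions.

(** * Bernstein approximation of Lipschitz functions *)

Section Bernstein.
Variable R : realType.

(* De Casteljau's algorithm: [casteljau a n 0] is the Bernstein polynomial of
   degree [n] with coefficients [a 0, ..., a n]. *)
Fixpoint casteljau (a : nat -> R) (n j : nat) : {poly R} :=
  if n is n'.+1 then
    (1 - 'X) * casteljau a n' j + 'X * casteljau a n' j.+1
  else (a j)%:P.

(** The factor of [gamma] is the expectation of [(j + S - c)^2] for a binomial variable [S] with
    parameters [n] and [x]. It obeys the same recursion as [casteljau], so the induction step ends
    in an identity. *)
Lemma casteljau_dist (a : nat -> R) (N : nat) (x v alpha gamma c : R) :
  0 <= x <= 1 ->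
  (forall k, (k <= N)%N -> `|a k - v| <= alpha + gamma * (k%:R - c) ^+ 2) ->
  forall n j, (n + j <= N)%N -> `|(casteljau a n j).[x] - v| <=
    alpha + gamma * ((j%:R + n%:R * x - c) ^+ 2 + n%:R * x * (1 - x)).
Proof.
move=> /andP[x0 x1] ha; elim=> [|n IH] j hj /=.
  by rewrite hornerC !mul0r !addr0 ha.
rewrite !hornerE.
set p := (casteljau a n j).[x]; set q := (casteljau a n j.+1).[x].
have x1' : 0 <= 1 - x by rewrite subr_ge0.
have -> : (1 - x) * p + x * q - v = (1 - x) * (p - v) + x * (q - v) by ring.
apply: le_trans (ler_normD _ _) _.
rewrite !normrM (ger0_norm x0) (ger0_norm x1').
have h1 : `|p - v| <= _ := IH j (ltnW hj).
have h2 : `|q - v| <= _ := IH j.+1 (leq_trans (eq_leq (addnS _ _)) hj).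
apply: le_trans (lerD (ler_wpM2l x1' h1) (ler_wpM2l x0 h2)) _.
by rewrite le_eqVlt; apply/predU1P; left; rewrite -!natr1; ring.
Qed.

Lemma lipschitz_poly_approx (f : R -> R) (M L : R) : 0 < M ->
  (forall x y, 0 <= x <= M -> 0 <= y <= M -> `|f x - f y| <= L * `|x - y|) ->
  forall e : R, 0 < e -> exists p : {poly R},
    forall t : R, 0 <= t <= M -> `|p.[t] - f t| <= e.
Proof.
move=> M0 hL e e0.
(* With [key] and [c = n x], the error is at most [e / 2 + 2 e (B / n) x (1 - x)]. As
   [x (1 - x) <= 1/4], any [n >= B] makes this at most [e]. *)
pose B := (L * M) ^+ 2 / (4 * e ^+ 2).
have [n n0 nB] : exists2 n : nat, 0 < n%:R :> R & B <= n%:R.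
  by exists (Num.truncn B).+1; rewrite ?ltr0Sn // ltW // truncnS_gt.
pose a k := f (M * (k%:R / n%:R)).
exists ((casteljau a n 0) \Po (M^-1 *: 'X)) => t /andP[t0 tM].
rewrite horner_comp !hornerE; set x := M^-1 * t.
have tE : t = M * x by rewrite /x mulrA mulfV ?mul1r // gt_eqF.
have x01 : 0 <= x <= 1.
  by rewrite /x mulr_ge0 ?invr_ge0 ?(ltW M0) //= mulrC ler_pdivrMr // mul1r.
have key k : (k <= n)%N ->
    `|a k - f t| <=
      e / 2 + (L * M / n%:R) ^+ 2 / (2 * e) * (k%:R - n%:R * x) ^+ 2.
  move=> kn; rewrite /a.
  have kn1 : 0 <= (k%:R / n%:R : R) <= 1.
    by rewrite divr_ge0 ?ler0n //= ler_pdivrMr // mul1r ler_nat.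
  apply: le_trans (hL _ _ _ _) _; rewrite ?t0 ?tM //.
    by case/andP: kn1 => h1 h2; rewrite mulr_ge0 ?ler_piMr ?(ltW M0).
  rewrite tE -mulrBr normrM (gtr0_norm M0).
  have -> : k%:R / n%:R - x = (k%:R - n%:R * x) / n%:R by field; rewrite gt_eqF.
  rewrite normrM (gtr0_norm (_ : 0 < n%:R^-1)) ?invr_gt0 //.
  set y := _ - _; rewrite -(real_normK (num_real y)).
  set z := `|y|.
  (* AM-GM: [L M z / n <= e / 2 + (L M z / n)^2 / (2 e)] *)
  have : 0 <= (L * M / n%:R * z - e) ^+ 2 / (2 * e).
    by rewrite divr_ge0 ?sqr_ge0 ?mulr_ge0 ?(ltW e0).
  have -> : (L * M / n%:R * z - e) ^+ 2 / (2 * e) =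
     e / 2 + (L * M / n%:R) ^+ 2 / (2 * e) * z ^+ 2 - L * (M * (z / n%:R)).
    by field; rewrite !gt_eqF.
  by rewrite subr_ge0.
have := casteljau_dist x01 key (n := n) (j := 0).
rewrite addn0 => /(_ (leqnn _)).
rewrite add0r subrr expr0n add0r => /le_trans; apply.
have xx : x * (1 - x) <= 4^-1.
  have := sqr_ge0 (x - 2^-1); rewrite expr2; lra.
have -> : (L * M / n%:R) ^+ 2 / (2 * e) * (n%:R * x * (1 - x)) =
   2 * e * (B / n%:R) * (x * (1 - x)) by rewrite /B; field; rewrite !gt_eqF.
have Bn : B / n%:R <= 1 by rewrite ler_pdivrMr // mul1r.
have B0 : 0 <= B / n%:R.
  by rewrite divr_ge0 ?(ltW n0) // divr_ge0 ?sqr_ge0 // mulr_ge0 ?sqr_ge0.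
case/andP: x01 => h1 h2.
have h3 : 0 <= x * (1 - x) by rewrite mulr_ge0 // subr_ge0.
have : B / n%:R * (x * (1 - x)) <= 1 * 4^-1 by rewrite ler_pM.
move=> h; have := ler_wpM2l (ltW e0) h; lra.
Qed.

End Bernstein.

(** * Functional calculus and Jensen's inequality *)

Section FunctionalCalculus.
Variables (R : realType) (X : Type) (H : rkHilbert R X).
Local Notation C := R[i].
Local Notation "x %:C" := (real_complex R x) : ring_scope.
Variables (f : R -> R) (T : H -> H).
Hypotheses (hf : orlicz f) (bT : bounded_op T) (sT : selfadj T).
Hypothesis pT : forall u, 0 <= rip (T u) u.

(** If [p n] is within [1/(n+1)] of [f], then [p m] and [p n] differ by at most [delta n] for
    [m >= n]. *)
Let delta (n : nat) : R := 2 / n.+1%:R.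

Let delta_small (K e : R) : 0 < e ->
  exists n0 : nat, forall n, (n0 <= n)%N -> delta n * K <= e.
Proof.
move=> e0; exists (Num.truncn (2 * `|K| / e)) => n hn.
apply: (@le_trans _ _ (delta n * `|K|)).
  by rewrite ler_wpM2l ?ler_norm // divr_ge0.
rewrite /delta mulrAC ler_pdivrMr ?ltr0Sn // [leRHS]mulrC -ler_pdivrMr //.
by apply: le_trans (ltW (truncnS_gt _)) _; rewrite ler_nat ltnS.
Qed.

Let le0_delta (K x : R) : (forall n, x <= delta n * K) -> x <= 0.
Proof.
move=> h; apply/ler_addgt0Pr => e e0; rewrite add0r.
by have [n0 hn] := delta_small K e0; apply: le_trans (h n0) (hn _ (leqnn _)).
Qed.

(** Polynomials approximating [f] uniformly on an interval that contains the real spectrum give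
    operators that are Cauchy in norm, by [poly_op_norm_le]; [S] is their pointwise limit, with the
    uniform rate [delta]. *)
Let cfc_ex : exists S, is_cfc f T S.
Proof.
have [M M0 hM] := bounded_op_bound bT.
have M1 : 0 < M + 1 by rewrite ltr_wpDl.
have spM t : spectrum T t%:C -> 0 <= t <= M + 1.
  move=> /(spectrum_bounds bT sT pT hM) /andP[-> tM]; rewrite (le_trans tM) //.
  by rewrite lerDl.
have /choice [p hp] : forall n : nat, exists p : {poly R},
    forall t, 0 <= t <= M + 1 -> `|p.[t] - f t| <= n.+1%:R^-1.
  move=> n; apply: (@lipschitz_poly_approx _ _ _ (f (M + 1 + 1)) M1).
    by move=> x y hx hy; apply: orlicz_lipschitz => //; exact: ltW.
  by rewrite invr_gt0 ltr0Sn.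
pose G n := poly_op (p n) T.
have inv_le m n : (n <= m)%N -> (m.+1%:R^-1 : R) <= n.+1%:R^-1.
  by move=> nm; rewrite lef_pV2 ?posrE ?ltr0Sn // ler_nat ltnS.
have GC n m u : (n <= m)%N -> hnorm (G m u - G n u) <= delta n * hnorm u.
  move=> nm; rewrite -poly_opB //.
  apply: poly_op_norm_le => //; first by rewrite divr_ge0.
  move=> t /spM ht; rewrite !hornerE.
  have := hp m t ht; have := hp n t ht; have := inv_le _ _ nm.
  rewrite !ler_norml => h1 /andP[h2 h3] /andP[h4 h5].
  rewrite /delta; move: h1 h2 h3 h4 h5.
  move: (m.+1%:R^-1) (n.+1%:R^-1) => x y *.
  by apply/andP; split; lra.
have /choice [S hS] : forall u, exists l, forall e : R, 0 < e ->
    exists n0 : nat, forall n : nat, (n0 <= n)%N -> hnorm (G n u - l) <= e.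
  move=> u; apply: hnorm_complete => e e0.
  have [|n0 hn0] := @delta_small (hnorm u) (e / 2); first by rewrite divr_gt0.
  exists n0 => m n hm hn.
  rewrite -(subrKA (G n0 u)).
  apply: le_trans (ler_hnormD _ _) _; rewrite [in X in _ + X]hnorm_distC.
  have := GC _ _ u hm; have := GC _ _ u hn; have := hn0 _ (leqnn n0); lra.
have GS n u : hnorm (G n u - S u) <= delta n * hnorm u.
  apply/ler_addgt0Pr => e e0; have [n0 hn0] := hS u e e0.
  have h1 := hn0 _ (leq_maxl n0 n); have h2 := GC _ _ u (leq_maxr n0 n).
  rewrite -(subrKA (G (maxn n0 n) u)).
  apply: le_trans (ler_hnormD _ _) _; rewrite hnorm_distC; apply: lerD h2 h1.
exists S; split.
  have lS : linear S.
    move=> a u v; apply/eqP; rewrite -subr_eq0; apply/eqP/hnorm_eq0/eqP.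
    rewrite eq_le hnorm_ge0 andbT.
    pose K := hnorm (a *: u + v) + Normc.normc a * hnorm u + hnorm v.
    apply: (@le0_delta K) => n.
    have lG : linear (G n) := proj1 (poly_op_bounded bT (p n)).
    (* As [G n] is linear, the defect of linearity of [S] consists only of approximation errors. *)
    have -> : S (a *: u + v) - (a *: S u + S v) =
        - (G n (a *: u + v) - S (a *: u + v)) +
        (a *: (G n u - S u) + (G n v - S v)).
      by rewrite lG scalerBr opprB [X in _ = _ + X]addrACA -opprD subrKA.
    apply: le_trans (ler_hnormD _ _) _.
    rewrite opp_hnorm /K -addrA mulrDr lerD //; apply: le_trans (ler_hnormD _ _) _.
    rewrite hnormZ mulrDr lerD // mulrCA ler_wpM2l //; exact: normc_ge0.
  have [K K0 hK] := bounded_op_bound (poly_op_bounded bT (p 0%N)).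
  apply: (@bound_bounded_op _ _ _ _ (K + delta 0)) => // u.
  have -> : S u = G 0%N u - (G 0%N u - S u) by rewrite opprB addrC subrK.
  apply: le_trans (ler_hnormD _ _) _; rewrite opp_hnorm mulrDl.
  by apply: lerD; [exact: hK|exact: GS].
exists p; split=> e e0.
  have [n0 hn0] := delta_small 1 e0.
  exists n0 => // n /= hn t /spM ht; apply: le_trans (hp _ _ ht) _.
  apply: le_trans (hn0 _ hn).
  by rewrite mulr1 /delta ler_peMl ?ler1n ?invr_ge0.
have [n0 hn0] := delta_small 1 e0.
exists n0 => // n /= hn u; rewrite !normE -rmorphM lecR.
apply: le_trans (GS n u) _; rewrite ler_wpM2r ?hnorm_ge0 //.
by have := hn0 _ hn; rewrite mulr1.
Qed.

Lemma cfcP : is_cfc f T (cfc f T).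
Proof. exact: (@xgetPex _ (fun=> 0) [set S | is_cfc f T S] cfc_ex). Qed.

(** On the spectrum [f] stays above its supporting line at [c = rip (T u) u]. Passing to the
    operators by [poly_op_lower_bound], the linear term cancels at [u]. One [e / 2] pays for [p n]
    against [f], the other for [p n] of [T] against [f(T)]. *)
Lemma cfc_jensen u : hnorm u = 1 -> f (rip (T u) u) <= rip (cfc f T u) u.
Proof.
move=> u1; have [bS [p [hp1 hp2]]] := cfcP.
have [M M0 hM] := bounded_op_bound bT.
set c := rip (T u) u.
have [m hm] := orlicz_support hf (pT u).
apply/ler_addgt0Pr => e e0.
have e20 : 0 < e / 2 by rewrite divr_gt0.
have [n1 _ h1] := hp1 _ e20; have [n2 _ h2] := hp2 _ e20.
pose n := maxn n1 n2.
have {}h1 := h1 n (leq_maxl _ _); have {}h2 := h2 n (leq_maxr _ _) u.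
have lb (t : R) : spectrum T t%:C ->
    f c - m * c - e / 2 <= (p n - m%:P * 'X).[t].
  move=> ht; have /andP[t0 _] := spectrum_bounds bT sT pT hM ht.
  have := hm t t0; have := h1 t ht.
  by rewrite ler_norml !hornerE -/c => /andP[h3 _]; lra.
have := poly_op_lower_bound bT sT lb u.
rewrite poly_opB // poly_opM // poly_opC // poly_opX // ripBl ripZl -/c.
rewrite u1 expr1n mulr1.
move: h2; rewrite !normE -rmorphM lecR u1 mulr1 => h2.
have := le_trans (ler_norm _) (rip_CS (poly_op (p n) T u - cfc f T u) u).
rewrite ripBl u1 mulr1; lra.
Qed.

End FunctionalCalculus.

(** * Berezin number and Berezin norm *)

Lemma mean_ge_lb (R : realType) (s : R -> R -> R) (a b c : R) : is_mean s ->
  0 <= c -> c <= a -> c <= b -> c <= s a b.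
Proof.
move=> hs c0 ca cb.
have /andP[cs _] := mean_between hs c0 (lexx c).
exact: le_trans cs (mean_mono hs c0 ca c0 cb).
Qed.

(** This carries a bound at each kernel over to the Berezin number. It is a continuity argument: [f]
    has Lipschitz constant [L] on [[0, s^4]], and [s^4 - x^4 <= 4 s^3 (s - x)]. *)
Lemma orlicz_sup_expr4 (R : realType) (f : R -> R) (E : set R) (r : R) :
  orlicz f -> has_sup E -> (forall x, E x -> 0 <= x) ->
  (forall x, E x -> f (x ^+ 4) <= r) -> f (sup E ^+ 4) <= r.
Proof.
move=> hf hE E0 hr; set s := sup E.
have s0 : 0 <= s.
  by have [[x Ex] _] := hE; apply: le_trans (E0 _ Ex) _; exact: sup_upper_bound.
have s40 : 0 <= s ^+ 4 by exact: exprn_ge0.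
pose L := f (s ^+ 4 + 1).
have L0 : 0 <= L by apply: orlicz_ge0 => //; rewrite addr_ge0.
pose K := L * (4 * s ^+ 3) + 1.
have K0 : 0 < K by rewrite ltr_wpDl // mulr_ge0 // mulr_ge0 // exprn_ge0.
apply/ler_addgt0Pr => e e0.
have eK : 0 < e / K by rewrite divr_gt0.
have [x Ex sx] := sup_adherent eK hE; rewrite -/s in sx.
have x0 := E0 x Ex; have xs : x <= s by exact: sup_upper_bound.
have x4s : x ^+ 4 <= s ^+ 4 by exact: lerXn2r.
have := @orlicz_lipschitz _ f hf (s ^+ 4) (s ^+ 4) (x ^+ 4) s40.
rewrite s40 lexx exprn_ge0 // x4s => /(_ isT isT).
have h1 : s ^+ 4 - x ^+ 4 <= 4 * s ^+ 3 * (e / K).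
  have -> : s ^+ 4 - x ^+ 4 = (s - x) * ((s + x) * (s ^+ 2 + x ^+ 2)) by ring.
  have h3 : (s + x) * (s ^+ 2 + x ^+ 2) <= 4 * s ^+ 3.
    have -> : 4 * s ^+ 3 = (s + s) * (s ^+ 2 + s ^+ 2) by ring.
    by rewrite ler_pM ?addr_ge0 ?sqr_ge0 // lerD2l // lerXn2r.
  rewrite mulrC; apply: ler_pM h3 _; rewrite ?subr_ge0 //.
    by rewrite mulr_ge0 ?addr_ge0 ?sqr_ge0.
  by lra.
rewrite [X in _ * X]ger0_norm ?subr_ge0 // -/L => h2.
have h3 : L * (s ^+ 4 - x ^+ 4) <= e.
  apply: le_trans (ler_wpM2l L0 h1) _.
  have -> : L * (4 * s ^+ 3 * (e / K)) = (K - 1) / K * e.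
    by rewrite /K; field; rewrite -/K gt_eqF.
  by rewrite ler_piMl ?(ltW e0) // ler_pdivrMr // mul1r gerBl.
have := hr x Ex; have := ler_norm (f (s ^+ 4) - f (x ^+ 4)); lra.
Qed.

Section Berezin.
Variables (R : realType) (X : Type) (H : rkHilbert R X).
Local Notation C := R[i].
Local Notation "x %:C" := (real_complex R x) : ring_scope.
Local Notation "''[' u , v ]" := (rk_inner H u v) : ring_scope.
Implicit Types (u v w : H) (T S A B : H -> H).

Lemma bounded_op_comp T S : bounded_op T -> bounded_op S -> bounded_op (T \o S).
Proof.
move=> bT bS; have [M M0 hM] := bounded_op_bound bT.
have [K K0 hK] := bounded_op_bound bS.
apply: (@bound_bounded_op _ _ _ _ (M * K)) => [a u v|u] /=.
  by rewrite (proj1 bS) (proj1 bT).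
by apply: le_trans (hM _) _; rewrite -mulrA ler_wpM2l.
Qed.

Lemma bounded_op_add T S : bounded_op T -> bounded_op S -> bounded_op (T \+ S).
Proof.
move=> bT bS; have [M M0 hM] := bounded_op_bound bT.
have [K K0 hK] := bounded_op_bound bS.
apply: (@bound_bounded_op _ _ _ _ (M + K)) => [a u v|u] /=.
  by rewrite (proj1 bS) (proj1 bT) scalerDr addrACA.
by apply: le_trans (ler_hnormD _ _) _; rewrite mulrDl lerD.
Qed.

Lemma inner_adjointl A u v : bounded_op A -> '[adjoint A u, v] = '[u, A v].
Proof. by move=> /adjointP [_ h]; rewrite inner_conj -h -inner_conj. Qed.

Lemma gram_bounded A : bounded_op A -> bounded_op (adjoint A \o A).
Proof. by move=> bA; apply: bounded_op_comp => //; have [] := adjointP bA. Qed.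

Lemma gram_inner A u v : bounded_op A ->
  '[(adjoint A \o A) u, v] = '[u, (adjoint A \o A) v].
Proof.
by move=> bA; rewrite /= inner_adjointl // (proj2 (adjointP bA)).
Qed.

Lemma gram_selfadj A : bounded_op A -> selfadj (adjoint A \o A).
Proof. by move=> bA u v; rewrite /rip gram_inner. Qed.

Lemma gram_rip A u : bounded_op A ->
  rip ((adjoint A \o A) u) u = hnorm (A u) ^+ 2.
Proof. by move=> bA; rewrite -ripE /rip /= inner_adjointl. Qed.

(* [2 * <u, k> k - u] is the reflection of [u] in the line through [k], so it
   has the same norm as [u]. *)
Lemma buzano u v k : hnorm k = 1 ->
  rip u k * rip v k <= (hnorm u * hnorm v + rip u v) / 2.
Proof.
move=> k1; pose w := (2 * rip u k)%:C *: k - u.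
have wE : hnorm w = hnorm u.
  apply/eqP; rewrite -(eqrXn2 (n := 2)) ?hnorm_ge0 // -!ripE /w.
  rewrite ripBl !ripBr !ripZl !ripZr [rip k k]ripE k1 expr1n [rip k u]ripC.
  by apply/eqP; ring.
have := le_trans (ler_norm _) (rip_CS w v).
rewrite wE /w ripBl ripZl [rip k v]ripC; lra.
Qed.

Lemma nkernel_norm x : rkernel H x != 0 -> hnorm (nkernel H x) = 1.
Proof. by move=> /hnorm_normalize; rewrite /nkernel normE fmorphV. Qed.

Section Bounds.
Hypotheses (X_neq0 : [set: X] !=set0) (k_neq0 : forall x : X, rkernel H x != 0).

Lemma inner_nkernel_le T : bounded_op T -> exists M : R, forall x y,
  Normc.normc '[T (nkernel H x), nkernel H y] <= M.
Proof.
move=> /bounded_op_bound [M M0 hM]; exists M => x y.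
apply: le_trans (inner_CS _ _) _; rewrite nkernel_norm // mulr1.
by apply: le_trans (hM _) _; rewrite nkernel_norm // mulr1.
Qed.

Lemma has_sup_ber T : bounded_op T ->
  has_sup (range (fun x : X => Normc.normc '[T (nkernel H x), nkernel H x])).
Proof.
move=> /inner_nkernel_le [M hM]; have [x _] := X_neq0; split.
  by exists (Normc.normc '[T (nkernel H x), nkernel H x]), x.
by exists M => _ [y _ <-].
Qed.

Lemma ber_ge T x : bounded_op T ->
  Normc.normc '[T (nkernel H x), nkernel H x] <= ber T.
Proof. by move=> bT; apply: sup_upper_bound; [exact: has_sup_ber|exists x]. Qed.

Lemma ber_norm_ge T x y : bounded_op T ->
  Normc.normc '[T (nkernel H x), nkernel H y] <= ber_norm T.
Proof.
move=> /inner_nkernel_le [M hM]; apply: sup_upper_bound; last by exists (x, y).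
split; first by exists (Normc.normc '[T (nkernel H x), nkernel H y]), (x, y).
by exists M => _ [[x' y'] _ <-].
Qed.

End Bounds.
End Berezin.

(** * Assembly of the Berezin number inequality *)

Theorem theorem3p1 (R : realType) (X : Type) (H : rkHilbert R X)
  (X_neq0 : [set: X] !=set0)
  (kernel_neq0 : forall x : X, rkernel H x != 0)
  (A B : H -> H) (hA : bounded_op A) (hB : bounded_op B)
  (sigma rho tau : R -> R -> R) (sigma_ rho_ tau_ : R -> R -> R -> R)
  (hsigma : symmetric_mean sigma) (hrho : symmetric_mean rho)
  (htau : symmetric_mean tau)
  (hsigma_ : interpolational_path sigma sigma_)
  (hrho_ : interpolational_path rho rho_)
  (htau_ : interpolational_path tau tau_)
  (mu nu lambda : R) (hmu : 0 <= mu <= 1) (hnu : 0 <= nu <= 1)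
  (hlambda : 0 <= lambda <= 1)
  (f : R -> R) (hf : orlicz f) (f_mult : multiplicative_nneg f)
  (zeta : R) (hzeta : 0 <= zeta) :
  let AA := adjoint A \o A in
  let BB := adjoint B \o B in
  let N := ber_norm (cfc f (BB \o BB) \+ cfc f (AA \o AA)) in
  f (ber (adjoint A \o B) ^+ 4) <=
    (2 * zeta + 1) / (8 * zeta + 8) * N ^+ 2 +
    1 / (2 * zeta + 2) *
      rho_ lambda
        (sigma_ mu (f (ber (AA \o BB) ^+ 2)) (1 / 2 * f (ber (AA \o BB)) * N))
        (tau_ nu (f (ber (AA \o BB) ^+ 2)) (1 / 4 * N ^+ 2)).
Proof.
cbv zeta; set AA := adjoint A \o A; set BB := adjoint B \o B.
set N := ber_norm _.
have bAA : bounded_op AA by exact: gram_bounded.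
have bBB : bounded_op BB by exact: gram_bounded.
have sq_sa (P : H -> H) : selfadj P -> selfadj (P \o P).
  by move=> sP u v; rewrite /= !sP.
have sAA : selfadj AA by exact: gram_selfadj.
have sBB : selfadj BB by exact: gram_selfadj.
have sq_rip (P : H -> H) : selfadj P ->
    forall u, rip ((P \o P) u) u = hnorm (P u) ^+ 2.
  by move=> sP u; rewrite /= sP ripE.
have sq_ge0 (P : H -> H) : selfadj P -> forall u, 0 <= rip ((P \o P) u) u.
  by move=> sP u; rewrite sq_rip // sqr_ge0.
have bB2 := bounded_op_comp bBB bBB; have bA2 := bounded_op_comp bAA bAA.
have bF : bounded_op (cfc f (BB \o BB) \+ cfc f (AA \o AA)).
  by apply: bounded_op_add; apply: (proj1 (cfcP hf _ _ _)) => //; auto.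
have bAB := bounded_op_comp bAA bBB.
have bAsB : bounded_op (adjoint A \o B).
  by apply: bounded_op_comp => //; have [] := adjointP hA.
set b := ber (AA \o BB).
have b0 : 0 <= b.
  have [x _] := X_neq0.
  exact: le_trans (normc_ge0 _) (ber_ge X_neq0 kernel_neq0 x bAB).
have fM2 (x : R) : 0 <= x -> f (x ^+ 2) = f x ^+ 2.
  by move=> x0; rewrite !expr2 f_mult.
have N0 : 0 <= N.
  have [x _] := X_neq0.
  exact: le_trans (normc_ge0 _) (ber_norm_ge kernel_neq0 x x bF).
set m := f b; have m0 : 0 <= m by exact: orlicz_ge0.
rewrite (fM2 b) // -/m.
pose c := Num.min (m ^+ 2) (1 / 4 * N ^+ 2).
have c0 : 0 <= c by rewrite le_min sqr_ge0 mulr_ge0 ?divr_ge0 ?sqr_ge0.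
have cm : c <= m ^+ 2 by rewrite ge_min lexx.
have cN : c <= 1 / 4 * N ^+ 2 by rewrite ge_min lexx orbT.
(* [1 / 2 * m * N] is the geometric mean of [m^2] and [N^2 / 4], hence at least their minimum. *)
have cmN : c <= 1 / 2 * m * N.
  have [h|h] := leP m (1 / 2 * N).
    apply: le_trans cm _; have := ler_wpM2l m0 h; rewrite expr2; lra.
  apply: le_trans cN _; have := ler_wpM2r N0 (ltW h); rewrite expr2; lra.
have cle : c <= rho_ lambda (sigma_ mu (m ^+ 2) (1 / 2 * m * N))
                 (tau_ nu (m ^+ 2) (1 / 4 * N ^+ 2)).
  apply: (mean_ge_lb (path_mean hrho_ hlambda) c0).
    exact: (mean_ge_lb (path_mean hsigma_ hmu) c0 cm cmN).
  exact: (mean_ge_lb (path_mean htau_ hnu) c0 cm cN).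
apply: (@le_trans _ _ ((2 * zeta + 1) / (8 * zeta + 8) * N ^+ 2 +
                       1 / (2 * zeta + 2) * c)); last first.
  by rewrite lerD2l ler_wpM2l // divr_ge0 //; lra.
apply: orlicz_sup_expr4 => //; first exact: has_sup_ber.
  by move=> _ [x _ <-]; exact: normc_ge0.
move=> _ [x _ <-]; set k := nkernel H x; set g := Normc.normc _.
have k1 : hnorm k = 1 by exact: nkernel_norm.
pose s := rip (BB k) k * rip (AA k) k.
pose U := hnorm (BB k) * hnorm (AA k).
pose V := Normc.normc (rk_inner H ((AA \o BB) k) k).
have [P0 Q0] : 0 <= rip (BB k) k /\ 0 <= rip (AA k) k.
  by rewrite !gram_rip // !sqr_ge0.
have s0 : 0 <= s by exact: mulr_ge0.
have U0 : 0 <= U by rewrite mulr_ge0 ?hnorm_ge0.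
have V0 : 0 <= V by exact: normc_ge0.
(* [g] is the modulus of the inner product of [B k] and [A k], whose squared norms are the two
   factors of [s]. *)
have gs : g ^+ 4 <= s ^+ 2.
  have -> : g ^+ 4 = (g ^+ 2) ^+ 2 by rewrite -exprM.
  have gg : g <= hnorm (B k) * hnorm (A k).
    by rewrite /g /= inner_adjointl //; exact: inner_CS.
  rewrite lerXn2r ?nnegrE ?sqr_ge0 // /s !gram_rip // -exprMn.
  by rewrite lerXn2r ?nnegrE ?normc_ge0 ?mulr_ge0 ?hnorm_ge0.
have sU : s <= U.
  rewrite ler_pM //; (apply: le_trans (ler_norm _) _);
    by apply: le_trans (rip_CS _ _) _; rewrite k1 mulr1.
have sUV : s <= (U + V) / 2.
  apply: le_trans (buzano _ _ k1) _; rewrite ler_wpM2r // lerD2l.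
  apply: le_trans (ler_norm _) _; apply: le_trans (Re_le_normc _) _.
  by rewrite -(gram_inner (BB k) k hA).
have Vb : V <= b by exact: ber_ge.
have fP : f (hnorm (BB k) ^+ 2) <= rip (cfc f (BB \o BB) k) k.
  by rewrite -sq_rip //; apply: cfc_jensen => //; [exact: sq_sa|exact: sq_ge0].
have fQ : f (hnorm (AA k) ^+ 2) <= rip (cfc f (AA \o AA) k) k.
  by rewrite -sq_rip //; apply: cfc_jensen => //; [exact: sq_sa|exact: sq_ge0].
(* The sum is a diagonal value, at the pair [(x, x)], in the supremum defining [N]. *)
have fPQ : f (hnorm (BB k) ^+ 2) + f (hnorm (AA k) ^+ 2) <= N.
  apply: le_trans (lerD fP fQ) _; rewrite -ripDl.
  apply: le_trans (ler_norm _) _; apply: le_trans (Re_le_normc _) _.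
  exact: ber_norm_ge.
(* Multiplicativity splits [f (U^2)] into a product [p q], and [p q <= ((p + q) / 2)^2]. *)
have fU : f (U ^+ 2) <= 1 / 4 * N ^+ 2.
  rewrite /U exprMn f_mult ?sqr_ge0 //.
  have p0 := orlicz_ge0 hf (sqr_ge0 (hnorm (BB k))).
  have q0 := orlicz_ge0 hf (sqr_ge0 (hnorm (AA k))).
  move: fPQ p0 q0; move: (f _) (f _) => q p h q0 p0.
  have := sqr_ge0 (p - q).
  have : (p + q) ^+ 2 <= N ^+ 2 by rewrite ler_sqr ?nnegrE ?addr_ge0.
  by rewrite !expr2; lra.
have fV : f (V ^+ 2) <= m ^+ 2.
  by rewrite fM2 // lerXn2r ?nnegrE ?orlicz_ge0 //; apply: orlicz_mono.
have z8 : (2 * zeta + 1) / (8 * zeta + 8) =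
    (2 * zeta + 1) / (2 * zeta + 2) * (1 / 4).
  by field; apply/andP; split; rewrite gt_eqF //; lra.
have z2 : 1 / (2 * zeta + 2) = 1 - (2 * zeta + 1) / (2 * zeta + 2).
  by field; rewrite gt_eqF //; lra.
set a := (2 * zeta + 1) / (2 * zeta + 2) in z8 z2.
have a01 : 0 <= a <= 1.
  by rewrite divr_ge0 ?ler_pdivrMr ?mul1r //=; lra.
apply: (@le_trans _ _ (f (s ^+ 2))).
  by apply: orlicz_mono => //; exact: exprn_ge0 (normc_ge0 _).
rewrite z8 z2.
have [a0 a1] := andP a01.
have [h|h] := leP (m ^+ 2) (1 / 4 * N ^+ 2).
  rewrite /c min_l //.
  (* The right-hand side is [(2 a - 1) U^2 + (2 - 2 a) (U^2 + V^2) / 2], a convex combination of two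
     bounds on [s^2], because [zeta >= 0] gives [a >= 1/2]. *)
  have s2 : s ^+ 2 <= a * U ^+ 2 + (1 - a) * V ^+ 2.
    have h1 : s ^+ 2 <= U ^+ 2 by rewrite lerXn2r.
    have h2 : s ^+ 2 <= (U ^+ 2 + V ^+ 2) / 2.
      have : s ^+ 2 <= ((U + V) / 2) ^+ 2.
        by rewrite lerXn2r ?nnegrE // divr_ge0 // addr_ge0.
      have := sqr_ge0 (U - V); rewrite !expr2; lra.
    have : 2^-1 <= a.
      rewrite /a ler_pdivlMr; lra.
    nra.
  apply: le_trans (orlicz_mono hf (sqr_ge0 _) s2) _.
  apply: le_trans (orlicz_conv hf a01 (sqr_ge0 _) (sqr_ge0 _)) _.
  rewrite -mulrA lerD // ler_wpM2l // subr_ge0 //.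
(* When the minimum is [N^2 / 4], the weights [a] and [1 - a] recombine to [N^2 / 4], which [fU]
   already bounds from below. *)
rewrite /c min_r ?(ltW h) //.
have : f (s ^+ 2) <= f (U ^+ 2).
  by apply: orlicz_mono; rewrite ?sqr_ge0 // lerXn2r.
lra.
Qed.
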